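(* Let $t\in\mathbb{Q}$ be arbitrary and let $X^{(2,t)}$ be the $K3$ surface over $\mathbb{Q}$ given by $$w^2=\left[\left(\tfrac18t^2-\tfrac12t+\tfrac14\right)y^2+(t^2-2t+2)yz+(t^2-4t+2)z^2\right]\left[\left(\tfrac18t^2+\tfrac12t+\tfrac14\right)x^2+(t^2+2t+2)xz+(t^2+4t+2)z^2\right]\left[2x^2+(t^2+2)xy+t^2y^2\right].$$ Then $\#X^{(2,t)}_p(\mathbb{F}_p)\equiv1\pmod p$ for every prime $p\equiv3,5\pmod 8$.
   Context: The equation defines a double cover of $\mathbb{P}^2_{\mathbb{Q}}$ (coordinates $x,y,z$; $w$ of weight $3$), branched over the union of six lines; the $K3$ surface is its minimal desingularization. For a prime $p\equiv 3,5 \pmod 8$, $X^{(2,t)}_p$ denotes the reduction modulo $p$, and its $\mathbb{F}_p$-rational points are counted on the double cover, i.e. on the surface in the weighted projective space $\mathbb{P}(1,1,1,3)$ over $\mathbb{F}_p$ given by the reduced equation. (At primes of good reduction, passing to the desingularization changes the number of points only by a multiple of $p$.) If $p$ divides the denominator of $t=a/b$ (lowest terms), one first multiplies each of the three quadratic forms by $b^2$ and replaces $w$ by $w/b^3$, which gives an isomorphic surface over $\mathbb{Q}$ whose equation has $p$-integral coefficients, and then reduces. *)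

(* Defs.v *)
From HB Require Import structures.
From mathcomp Require Import all_boot all_order all_algebra.
From mathcomp Require Import mpoly.

Set Implicit Arguments.
Unset Strict Implicit.
Unset Printing Implicit Defensive.

Import Order.TTheory GRing.Theory Num.Theory.
Local Open Scope ring_scope.

Definition ix : 'I_4 := @Ordinal 4 0 isT.
Definition iy : 'I_4 := @Ordinal 4 1 isT.
Definition iz : 'I_4 := @Ordinal 4 2 isT.
Definition iw : 'I_4 := @Ordinal 4 3 isT.

Section WeightedProjectiveSpace.

Variable F : finFieldType.

Definition weight (i : 'I_4) : nat := if i == iw then 3%N else 1%N.

Definition wscale (c : F) (v : {ffun 'I_4 -> F}) : {ffun 'I_4 -> F} :=
  [ffun i => c ^+ weight i * v i].

Definition wpoint (v : {ffun 'I_4 -> F}) : {set {ffun 'I_4 -> F}} :=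
  [set wscale c v | c in [set c : F | c != 0]].

(* F-rational points of the hypersurface f = 0 in P(1,1,1,3), as orbits of    *)
(* nonzero F-vectors under the weighted action of F^*.  Orbits agree with     *)
(* geometric rational points away from (0:0:0:1), where the stabilizer is     *)
(* nontrivial; an equation w^2 = f6(x,y,z) never passes through that point.   *)
Definition wpoints (f : {mpoly F[4]}) : {set {set {ffun 'I_4 -> F}}} :=
  [set wpoint v | v in [set v : {ffun 'I_4 -> F} | (v != 0) && (f.@[v] == 0)]].

End WeightedProjectiveSpace.

Section K3Family.

Variable t : rat.

Local Notation x := ('X_ix : {mpoly rat[4]}).
Local Notation y := ('X_iy : {mpoly rat[4]}).
Local Notation z := ('X_iz : {mpoly rat[4]}).
Local Notation w := ('X_iw : {mpoly rat[4]}).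

Definition qf_yz : {mpoly rat[4]} :=
  (1 / 8 * t ^+ 2 - 1 / 2 * t + 1 / 4) *: y ^+ 2
  + (t ^+ 2 - 2 * t + 2) *: (y * z) + (t ^+ 2 - 4 * t + 2) *: z ^+ 2.

Definition qf_xz : {mpoly rat[4]} :=
  (1 / 8 * t ^+ 2 + 1 / 2 * t + 1 / 4) *: x ^+ 2
  + (t ^+ 2 + 2 * t + 2) *: (x * z) + (t ^+ 2 + 4 * t + 2) *: z ^+ 2.

Definition qf_xy : {mpoly rat[4]} :=
  2 *: x ^+ 2 + (t ^+ 2 + 2) *: (x * y) + t ^+ 2 *: y ^+ 2.

Definition X2_eq : {mpoly rat[4]} := w ^+ 2 - qf_yz * qf_xz * qf_xy.

(* The equation over Q that is reduced modulo p.  If p divides the            *)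
(* denominator b of t, each form is multiplied by b^2 (i.e. w is replaced by  *)
(* w/b^3), which makes the coefficients p-integral for every odd p.           *)
Definition X2_model (p : nat) : {mpoly rat[4]} :=
  if (p %| `|denq t|)%N then
    let b2 : rat := (denq t)%:~R ^+ 2 in
    w ^+ 2 - (b2 *: qf_yz) * (b2 *: qf_xz) * (b2 *: qf_xy)
  else X2_eq.

(* On p-integral rationals, ratr : rat -> 'F_p is reduction modulo p.         *)
Definition X2_red (p : nat) : {mpoly 'F_p[4]} :=
  map_mpoly (ratr : rat -> 'F_p) (X2_model p).

End K3Family.

(* Main.v *)
(* Let m = (p - 1) / 2. Modulo p, the number of points is 1 - S, where S is    *)
(* the sum of f(x, y, z)^m over F_p^3 and w^2 = f(x, y, z) is the surface, so  *)
(* one has to show S = 0. Since 2^m = - 1 when p = 3, 5 mod 8, it suffices to  *)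
(* show S = 2^m S. Write t for the numerator and b for the denominator of the  *)
(* parameter, and n = t^4 - 12 t^2 b^2 + 4 b^4.                                *)
(*                                                                             *)
(* The sum of (q1 q2)^m over the line, for quadratics q1, q2, equals up to     *)
(* sign and boundary terms the sum over u of (u disc(u q1 + q2))^m. Applying   *)
(* this to z, then to (x : y), turns S into a sum over w of (w - c)^m l(R),    *)
(* where l(R) is the sum over r of ((r^2 - 4)(R r + 6 R - 4 n))^m, a family of *)
(* Legendre curves, R = w^2 - 8 t^2 b^2 and c = t^2 + 2 b^2. An affine change  *)
(* of r gives l(R) = l(n - R), that is, the symmetry w^2 -> c^2 - w^2.         *)
(* Whenever w^2 + w'^2 = c^2 one has (w + w' - c)^2 = 2 (w - c)(w' - c), so    *)
(* this symmetry multiplies the sum by 2^m.                                    *)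

Require Import Defs.
From mathcomp Require Import all_boot all_order all_algebra.
From mathcomp Require Import all_solvable all_field.
From mathcomp Require Import mpoly.
From mathcomp Require Import ring.

(** All identities live in the field [F] itself: [x ^+ m] is the quadratic character with values in
    [F], and constants sum to 0 over [F]. A congruence modulo [p] is an equality in ['F_p], so
    [card_wpoints_double_plane] reduces the theorem to [sum_sextic_eq0]. One exchange of summation,
    [sum_quadratic_pencil], performs both eliminations. The vanishing comes from two matching
    involutions, [sum_legendre_symmetry] on the curves and [sum_shifted_sqrt_duality] on the base,
    combined in [sum_symmetric_twist_eq0]; [two_nonsquare_Fp] supplies the sign. An integral model
    ([map_integral_model]) transfers the result to [X2_red]. *)

Section Reduction.
Import GRing.Theory.
Local Open Scope ring_scope.
Local Set Implicit Arguments.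
Local Unset Strict Implicit.
Local Unset Printing Implicit Defensive.

(* With t for the numerator and b for the denominator of the parameter, this   *)
(* is 64 b^6 times the product of the three forms; b = 0 covers the primes     *)
(* that divide the denominator.                                                *)
Definition sextic (R : pzRingType) (t b x y z : R) : R :=
  let A := t ^+ 2 - 2%:R * (t * b) + 2%:R * b ^+ 2 in
  let B := t ^+ 2 - 4%:R * (t * b) + 2%:R * b ^+ 2 in
  let A' := t ^+ 2 + 2%:R * (t * b) + 2%:R * b ^+ 2 in
  let B' := t ^+ 2 + 4%:R * (t * b) + 2%:R * b ^+ 2 in
    (B * y ^+ 2 + 8%:R * A * (y * z) + 8%:R * B * z ^+ 2)
  * (B' * x ^+ 2 + 8%:R * A' * (x * z) + 8%:R * B' * z ^+ 2)
  * (2%:R * b ^+ 2 * x ^+ 2 + (t ^+ 2 + 2%:R * b ^+ 2) * (x * y)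
     + t ^+ 2 * y ^+ 2).

(** * Quadratic character sums *)

Section QuadraticCharacterSums.
Variables (F : finFieldType) (m : nat).
Hypothesis cardF : #|F| = m.*2.+1.

Lemma half_card_gt0 : (0 < m)%N.
Proof. by have := finNzRing_gt1 F; rewrite cardF; case: m. Qed.

Lemma sum_const0 (a : F) : \sum_(x : F) a = 0.
Proof.
apply: (addIr (\sum_(x : F) x * a)); rewrite add0r -big_split /=.
rewrite [RHS](reindex_inj (addrI 1)) /=.
by apply: eq_bigr => x _; rewrite mulrDl mul1r.
Qed.

Lemma sum_affine (f : F -> F) (a b : F) : a != 0 ->
  \sum_x f (a * x + b) = \sum_x f x.
Proof.
move=> a0; rewrite [RHS](reindex_inj (h := fun x => a * x + b)) //.
by move=> x y /addIr /(mulfI a0).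
Qed.

Lemma expf_pred_card (x : F) : x != 0 -> x ^+ m.*2 = 1.
Proof.
move=> x0; apply: (mulfI x0).
by rewrite -exprS -cardF expf_card mulr1.
Qed.

Lemma expf_pred_cardE (x : F) : x ^+ m.*2 = (x != 0)%:R.
Proof.
have [->|/expf_pred_card //] := eqVneq x 0.
by rewrite expr0n double_eq0 eqn0Ngt half_card_gt0.
Qed.

Lemma exp0f_half : 0 ^+ m = 0 :> F.
Proof. by rewrite expr0n eqn0Ngt half_card_gt0. Qed.

Lemma expf_half_sqr (x : F) : x != 0 -> (x ^+ 2) ^+ m = 1.
Proof. by move=> x0; rewrite -exprM mul2n expf_pred_card. Qed.

Lemma expf_halfMsqr (x y : F) : x != 0 -> (x ^+ 2 * y) ^+ m = y ^+ m.
Proof. by move=> x0; rewrite exprMn expf_half_sqr ?mul1r. Qed.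

Lemma expf_half_sign (x : F) : x != 0 -> x ^+ m = 1 \/ x ^+ m = -1.
Proof.
move=> x0; apply/pred2P; rewrite -eqf_sqr expr1n -exprM muln2.
by rewrite expf_pred_card.
Qed.

Lemma two_neq0 : 2%:R != 0 :> F.
Proof.
have := sum_const0 1; rewrite sumr_const cardF => /eqP.
rewrite -add1n mulrnDr -mul2n mulrnA mulr1n => h; apply: contraTneq h => ->.
by rewrite mul0rn addr0 oner_eq0.
Qed.

Lemma euler_criterion (x : F) : x ^+ m = 1 -> exists y, x = y ^+ 2.
Proof.
move=> xm; have m2_gt0 : (0 < m.*2)%N by rewrite double_gt0 half_card_gt0.
have /hasP[z _ zP] :
    has m.*2.-primitive_root [seq u <- enum F | u != 0].
  apply: has_prim_root => //.
  - apply/allP => u; rewrite mem_filter => /andP[u0 _].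
    by apply/unity_rootP; rewrite expf_pred_card.
  - by rewrite filter_uniq ?enum_uniq.
  - rewrite size_filter -sum1_count big_enum_cond /= sum1_card.
    by rewrite (cardC1 (0 : F)) cardF.
have /(prim_rootP zP)[[i _] /= xE] : x ^+ m.*2 = 1.
  by rewrite -addnn exprD xm mulr1.
move: xm; rewrite xE -exprM => /eqP; rewrite -(prim_order_dvd zP) -mul2n.
rewrite dvdn_pmul2r ?half_card_gt0 // => /dvdnP[j ->].
by exists (z ^+ j); rewrite -exprM.
Qed.

(** Multiplication by [g] permutes [F] and scales the sum by [g ^+ m]; some [g != 0] has
    [g ^+ m != 1] because [X^m - 1] has at most [m] roots. *)
Lemma sum_half_power : \sum_(x : F) x ^+ m = 0.
Proof.
have m_gt0 := half_card_gt0.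
have [g g0 gm] : exists2 g : F, g != 0 & g ^+ m != 1.
  apply/exists_inP; rewrite -[X in is_true X]negbK negb_exists_in.
  apply/forall_inP => h.
  have : (size [seq u <- enum F | u != 0%R] <= m)%N.
    apply: max_unity_roots => //; last by rewrite filter_uniq ?enum_uniq.
    apply/allP => u; rewrite mem_filter => /andP[u0 _].
    by apply/unity_rootP/eqP; have := h u u0; rewrite negbK.
  rewrite size_filter -sum1_count big_enum_cond /= sum1_card.
  rewrite (cardC1 (0 : F)) cardF /= leqNgt -addnn.
  by rewrite -[X in (X < _)%N]addn0 ltn_add2l m_gt0.
have gS : g ^+ m * (\sum_(x : F) x ^+ m) = \sum_(x : F) x ^+ m.
  rewrite -[RHS](sum_affine _ 0 g0) mulr_sumr.
  by apply: eq_bigr => x _; rewrite addr0 exprMn.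
apply/eqP; have /eqP : (g ^+ m - 1) * (\sum_(x : F) x ^+ m) = 0.
  by rewrite mulrBl mul1r gS subrr.
by rewrite mulf_eq0 subr_eq0 (negPf gm).
Qed.

Lemma sum_linear_half (a b : F) : \sum_x (a * x + b) ^+ m = 0.
Proof.
have [->|a0] := eqVneq a 0.
  rewrite -[RHS](sum_const0 (b ^+ m)).
  by apply: eq_bigr => x _; rewrite mul0r add0r.
by rewrite (sum_affine (fun x => x ^+ m)) ?sum_half_power.
Qed.

Lemma sum_neq0_const (a : F) : \sum_(x : F | x != 0) a = - a.
Proof.
by have /eqP := sum_const0 a; rewrite (bigD1 0) //= addrC addr_eq0 => /eqP.
Qed.

Lemma sum_sqrt (f : F -> F) (v : F) : v != 0 ->
  \sum_(u | u ^+ 2 == v ^+ 2) f u = f v + f (- v).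
Proof.
move=> v0; have vNv : - v != v.
  by rewrite eq_sym -addr_eq0 -mulr2n -mulr_natl mulf_neq0 ?two_neq0.
rewrite (bigD1 v) //= (bigD1 (- v)) ?vNv ?sqrrN ?eqxx //=.
rewrite big_pred0 ?addr0 // => u.
by rewrite eqf_sqr; case: eqP => //= _; case: eqP.
Qed.

Lemma sum_sqrt0 (f : F -> F) : \sum_(u | u ^+ 2 == 0) f u = f 0.
Proof. by under eq_bigl do rewrite sqrf_eq0; rewrite big_pred1_eq. Qed.

Lemma sum_sqrt_nonsquare (f : F -> F) (d : F) : d ^+ m = - 1 ->
  \sum_(u | u ^+ 2 == d) f u = 0.
Proof.
move=> dm; rewrite big_pred0 // => u; apply: contraTF two_neq0 => /eqP uE.
have d0 : d != 0.
  by apply: contraTneq isT => d0; move/eqP: dm;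
    rewrite d0 exp0f_half eq_sym oppr_eq0 oner_eq0.
have u0 : u != 0 by apply: contraNneq d0 => u0; rewrite -uE u0 expr0n.
move: dm; rewrite -uE expf_half_sqr // => /eqP.
by rewrite -addr_eq0 => /eqP h; rewrite -[2%:R]/(1 + 1) h eqxx.
Qed.

Lemma card_sqrt (d : F) : \sum_(u : F | u ^+ 2 == d) 1 = 1 + d ^+ m.
Proof.
have [->|d0] := eqVneq d 0; first by rewrite sum_sqrt0 exp0f_half addr0.
have [dm|dm] := expf_half_sign d0;
  last by rewrite sum_sqrt_nonsquare // dm subrr.
have [v vE] := euler_criterion dm.
have v0 : v != 0 by apply: contraNneq d0 => v0; rewrite vE v0 expr0n.
by rewrite vE sum_sqrt // expf_half_sqr.
Qed.

(* The left-hand side is minus the number of zeros of the quadratic. *)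
Lemma sum_quadratic_pred_card (a b c : F) :
  \sum_x (a * x ^+ 2 + b * x + c) ^+ m.*2 =
  - a ^+ m.*2 - (b ^+ 2 - 4%:R * a * c) ^+ m.
Proof.
have two0 := two_neq0.
have four0 : 4%:R != 0 :> F by rewrite -[4%N]/(2 * 2)%N natrM mulf_neq0.
have [->|a0] := eqVneq a 0.
  rewrite [0 ^+ _]expf_pred_cardE eqxx oppr0 sub0r mulr0 mul0r subr0.
  rewrite -exprM mul2n.
  have [->|b0] := eqVneq b 0.
    rewrite [0 ^+ m.*2]expf_pred_cardE eqxx oppr0.
    rewrite -[RHS](sum_const0 (c ^+ m.*2)).
    by apply: eq_bigr => x _; congr (_ ^+ _); ring.
  under eq_bigr do rewrite mul0r add0r.
  rewrite (sum_affine (fun x => x ^+ m.*2)) // [in RHS]expf_pred_card //.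
  under eq_bigr do rewrite expf_pred_cardE.
  rewrite (bigD1 0) //= eqxx add0r.
  rewrite (eq_bigr (fun=> 1)) => [|x x0]; last by rewrite x0.
  exact: sum_neq0_const.
rewrite [in RHS]expf_pred_card //.
set d := b ^+ 2 - _.
have a20 : 2%:R * a != 0 by rewrite mulf_neq0.
rewrite (eq_bigr (fun x => ((2%:R * a * x + b) ^+ 2 - d) ^+ m.*2)) => [|x _];
  last first.
  have -> : (2%:R * a * x + b) ^+ 2 - d = (4%:R * a) * (a * x ^+ 2 + b * x + c).
    by rewrite /d; ring.
  by rewrite exprMn [(_ * a) ^+ _]expf_pred_card ?mul1r // mulf_neq0.
rewrite (sum_affine (fun x => (x ^+ 2 - d) ^+ m.*2)) //.
rewrite -opprD -card_sqrt; apply/eqP; rewrite -addr_eq0 addrC.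
rewrite [X in X + _]big_mkcond -big_split /=; apply/eqP.
rewrite -[RHS](sum_const0 1); apply: eq_bigr => u _.
rewrite expf_pred_cardE subr_eq0; case: eqP => _ /=;
  [exact: addr0|exact: add0r].
Qed.

(** For [a != 0], the factor with exponent [m.*2] only removes the root [- b / a] from a power sum
    that is 0. *)
Lemma sum_half_linear_pred_card (a b : F) :
  \sum_x x ^+ m * (a * x + b) ^+ m.*2 = - (- (a * b)) ^+ m.
Proof.
have [->|a0] := eqVneq a 0.
  rewrite !mul0r oppr0 exp0f_half oppr0.
  under eq_bigr do rewrite mul0r add0r.
  by rewrite -mulr_suml sum_half_power mul0r.
apply/eqP; rewrite -addr_eq0 -[X in _ + X](_ : (- (b / a)) ^+ m = _);
  last first.
  rewrite (_ : - (a * b) = a ^+ 2 * - (b / a)) ?expf_halfMsqr //.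
  by field.
rewrite (bigD1 (- (b / a))) //= (_ : a * - (b / a) + b = 0); last by field.
rewrite [0 ^+ _]expf_pred_cardE eqxx mulr0 add0r.
rewrite (eq_bigr (fun x => x ^+ m)) => [|x xE].
  by have := sum_half_power; rewrite (bigD1 (- (b / a))) //= addrC => /eqP.
rewrite expf_pred_card ?mulr1 //; apply: contra xE => h.
by rewrite -(inj_eq (mulfI a0)) mulrN [a * (_ / _)]mulrC divfK // -addr_eq0.
Qed.

(* For each T, the number of points of P^1 where T q1 + q2 vanishes is one     *)
(* plus the quadratic character of the discriminant; summing against the       *)
(* character of T = - q2 / q1 gives the identity.                              *)
Lemma sum_quadratic_pencil (a1 b1 c1 a2 b2 c2 : F) :
  \sum_x ((a1 * x ^+ 2 + b1 * x + c1) * (a2 * x ^+ 2 + b2 * x + c2)) ^+ m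
    + (a1 * a2) ^+ m =
  (- 1) ^+ m * \sum_u (u * ((u * b1 + b2) ^+ 2
                       - 4%:R * (u * a1 + a2) * (u * c1 + c2))) ^+ m.
Proof.
pose q1 x := a1 * x ^+ 2 + b1 * x + c1; pose q2 x := a2 * x ^+ 2 + b2 * x + c2.
(* The exponent [m.*2] gives the indicator of nonvanishing; the double sum is evaluated in both
   orders. *)
have : \sum_u \sum_x u ^+ m * (q1 x * u + q2 x) ^+ m.*2 =
       \sum_x - (- (q1 x * q2 x)) ^+ m.
  rewrite exchange_big; apply: eq_bigr => x _ /=.
  by rewrite sum_half_linear_pred_card.
have sgn : (- 1) ^+ m * (- 1) ^+ m = 1 :> F.
  by rewrite -exprMn mulrNN mul1r expr1n.
have -> : \sum_u \sum_x u ^+ m * (q1 x * u + q2 x) ^+ m.*2 =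
  \sum_u (- (u ^+ m * (a1 * u + a2) ^+ m.*2)
   - (u * ((u * b1 + b2) ^+ 2 - 4%:R * (u * a1 + a2) * (u * c1 + c2))) ^+ m).
  apply: eq_bigr => u _; rewrite -mulr_sumr.
  rewrite (eq_bigr (fun x => ((u * a1 + a2) * x ^+ 2 + (u * b1 + b2) * x
                              + (u * c1 + c2)) ^+ m.*2)); last first.
    by move=> x _; congr (_ ^+ _); rewrite /q1 /q2; ring.
  by rewrite sum_quadratic_pred_card [in RHS]exprMn [u * a1]mulrC; ring.
rewrite sumrB sumrN sum_half_linear_pred_card opprK sumrN (exprNn (a1 * a2)).
have -> : \sum_x (- (q1 x * q2 x)) ^+ m =
  (- 1) ^+ m * \sum_x (q1 x * q2 x) ^+ m.
  by rewrite mulr_sumr; apply: eq_bigr => x _; exact: exprNn.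
move=> h.
set S := \sum_u (u * _) ^+ m in h *; set S' := \sum_x (q1 x * _) ^+ m in h.
rewrite -/S'.
have -> : S = (-1) ^+ m * (S' + (a1 * a2) ^+ m).
  apply/eqP; rewrite -subr_eq0; apply/eqP; move/eqP: h;
    rewrite -subr_eq0 => /eqP h.
  by rewrite -[RHS]oppr0 -h; ring.
by rewrite mulrA sgn mul1r.
Qed.

(** In the pencil with second member 1, the summand at [u != 0] is a linear polynomial in [u] times
    the square [u ^+ 2]. *)
Lemma sum_quadratic_half (a b c : F) :
  \sum_x (a * x ^+ 2 + b * x + c) ^+ m = - a ^+ m.
Proof.
have := sum_quadratic_pencil a b c 0 0 1.
rewrite mulr0 exp0f_half addr0.
under eq_bigr do rewrite !mul0r !add0r mulr1.
move=> ->; rewrite (bigD1 0) //= mul0r exp0f_half add0r.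
rewrite (eq_bigr (fun u => ((b ^+ 2 - 4%:R * a * c) * u 
                            + - (4%:R * a)) ^+ m)) => [|u u0]; last first.
  rewrite -[RHS](expf_halfMsqr _ u0); congr (_ ^+ _); ring.
have := sum_linear_half (b ^+ 2 - 4%:R * a * c) (- (4%:R * a)).
rewrite (bigD1 0) //= mulr0 add0r addrC => /eqP; rewrite addr_eq0 => /eqP ->.
have two0 := two_neq0.
rewrite mulrN -exprMn mulN1r opprK (_ : 4%:R = 2%:R ^+ 2) ?expf_halfMsqr //;
  ring.
Qed.

Lemma sum_linear_neq0_half (a b : F) :
  \sum_(x | x != 0) (a * x + b) ^+ m = - b ^+ m.
Proof.
by have /eqP := sum_linear_half a b;
  rewrite (bigD1 0) //= mulr0 add0r addrC addr_eq0 => /eqP.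
Qed.

Lemma sum_binary_quadratic_half (a b c : F) :
  \sum_x \sum_y (a * x ^+ 2 + b * (x * y) + c * y ^+ 2) ^+ m = 0.
Proof.
rewrite exchange_big /= -[RHS](sum_const0 (- a ^+ m)).
apply: eq_bigr => y _; rewrite -(sum_quadratic_half a (b * y) (c * y ^+ 2)).
by apply: eq_bigr => x _; congr (_ ^+ _); ring.
Qed.

(** By homogeneity of degree 4, every [y != 0] contributes as much as [y = 1], and there are -1 such
    [y] in [F]; the row [y = 0] gives the boundary term of the pencil identity. *)
Lemma sum_binary_quadratic_pair (a1 b1 c1 a2 b2 c2 : F) :
  \sum_x \sum_y ((a1 * x ^+ 2 + b1 * (x * y) + c1 * y ^+ 2)
               * (a2 * x ^+ 2 + b2 * (x * y) + c2 * y ^+ 2)) ^+ m =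
  - (- 1) ^+ m * \sum_u (u * ((u * b1 + b2) ^+ 2
                       - 4%:R * (u * a1 + a2) * (u * c1 + c2))) ^+ m.
Proof.
rewrite mulNr -sum_quadratic_pencil exchange_big /= (bigD1 0) //=.
have -> : \sum_x ((a1 * x ^+ 2 + b1 * (x * 0) + c1 * 0 ^+ 2)
               * (a2 * x ^+ 2 + b2 * (x * 0) + c2 * 0 ^+ 2)) ^+ m =
                 - (a1 * a2) ^+ m.
  rewrite -sum_neq0_const (bigD1 0) //= [X in X ^+ m + _](_ : _ = 0);
    last by ring.
  rewrite exp0f_half add0r; apply: eq_bigr => x x0.
  rewrite -[RHS](@expf_halfMsqr (x ^+ 2)) ?expf_neq0 //.
  by congr (_ ^+ _); ring.
rewrite opprD [LHS]addrC; congr (_ + _).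
rewrite -sum_neq0_const; apply: eq_bigr => y y0.
rewrite -(sum_affine _ 0 y0); apply: eq_bigr => x _.
rewrite -[RHS](@expf_halfMsqr (y ^+ 2)) ?expf_neq0 //.
by congr (_ ^+ _); ring.
Qed.

(* Substitute (x / y) u for u. *)
Lemma sum_elliptic_twist (a g x y : F) :
  \sum_u (u * (a * y ^+ 2 * u ^+ 2 + g * u + a * x ^+ 2)) ^+ m =
  \sum_u (u * (a * (x * y) * u ^+ 2 + g * u + a * (x * y))) ^+ m.
Proof.
have [->|x0] := eqVneq x 0.
  rewrite !mul0r !mulr0 (bigD1 0) //= [RHS](bigD1 0) //=; congr (_ + _).
    by congr (_ ^+ _); ring.
  rewrite (eq_bigr (fun u => (a * y ^+ 2 * u + g) ^+ m)) => [|u u0]; last first.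
    by rewrite -[RHS](expf_halfMsqr _ u0); congr (_ ^+ _); ring.
  rewrite sum_linear_neq0_half -sum_neq0_const; apply: eq_bigr => u u0.
  by rewrite -[LHS](expf_halfMsqr _ u0); congr (_ ^+ _); ring.
have [->|y0] := eqVneq y 0.
  transitivity (- g ^+ m).
    rewrite -(sum_quadratic_half g (a * x ^+ 2) 0); apply: eq_bigr => u _.
    by congr (_ ^+ _); ring.
  rewrite -(sum_quadratic_half g 0 0); apply: eq_bigr => u _.
  by congr (_ ^+ _); ring.
have xy0 : x / y != 0 by rewrite mulf_neq0 ?invr_eq0.
rewrite -[LHS](sum_affine _ 0 xy0); apply: eq_bigr => u _.
by rewrite -[RHS](expf_halfMsqr _ xy0); congr (_ ^+ _); field.
Qed.

(* The quotient by u -> 1/u, with r = u + 1/u. *)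
Lemma sum_palindromic (a g : F) :
  \sum_u (u * (a * u ^+ 2 + g * u + a)) ^+ m =
  \sum_r ((r ^+ 2 - 4%:R) * (a * r + g)) ^+ m.
Proof.
have [->|a0] := eqVneq a 0.
  transitivity (- g ^+ m).
    rewrite -(sum_quadratic_half g 0 0); apply: eq_bigr => u _.
    by congr (_ ^+ _); ring.
  rewrite -(sum_quadratic_half g 0 (- 4%:R * g)); apply: eq_bigr => u _.
  by congr (_ ^+ _); ring.
(* The pencil of [u] and [a u^2 + g u + a] has discriminant [(T + g)^2 - 4 a^2]; then
   [T = - (a r + g)]. *)
have := sum_quadratic_pencil 0 1 0 a g a.
rewrite mul0r exp0f_half addr0 mulr_sumr => h.
transitivity
    (\sum_x ((0 * x ^+ 2 + 1 * x + 0) * (a * x ^+ 2 + g * x + a)) ^+ m).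
  by apply: eq_bigr => u _; congr (_ ^+ _); ring.
rewrite h -[LHS](sum_affine _ (- g) (_ : - a != 0)) ?oppr_eq0 //.
apply: eq_bigr => r _; rewrite -exprMn -[RHS](expf_halfMsqr _ a0).
by congr (_ ^+ _); ring.
Qed.

(* The affine map r |-> ((n - R) r + 2 (n - 2 R)) / R fixes the branch point   *)
(* - 2 and moves 2 to the third branch point.                                  *)
Lemma sum_legendre_symmetry (n R : F) :
  \sum_r ((r ^+ 2 - 4%:R) * (R * r + (6%:R * R - 4%:R * n))) ^+ m =
  \sum_r ((r ^+ 2 - 4%:R) * ((n - R) * r + (6%:R * (n - R) - 4%:R * n))) ^+ m.
Proof.
have two0 := two_neq0.
(* The affine map breaks down at [R = 0] and [R = n]: one cubic drops in degree, the other is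
   divisible by [(r + 2)^2]. *)
have degenerate (k : F) :
    \sum_r ((r ^+ 2 - 4%:R) * (0 * r + (6%:R * 0 - 4%:R * k))) ^+ m =
    \sum_r ((r ^+ 2 - 4%:R) * (k * r + (6%:R * k - 4%:R * k))) ^+ m.
  transitivity (- (- 4%:R * k) ^+ m).
    rewrite -(sum_quadratic_half (- 4%:R * k) 0 (4%:R * 4%:R * k)).
    by apply: eq_bigr => u _; congr (_ ^+ _); ring.
  rewrite -(sum_linear_neq0_half k) -[RHS](sum_affine _ (- 2%:R) (oner_neq0 F)).
  rewrite [RHS](bigD1 0) //= [X in X ^+ m + _](_ : _ = 0); last by ring.
  rewrite exp0f_half add0r; apply: eq_bigr => u u0.
  by rewrite -[LHS](expf_halfMsqr _ u0); congr (_ ^+ _); ring.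
have [->|R0] := eqVneq R 0; first by rewrite subr0 degenerate.
have [->|nR] := eqVneq n R; first by rewrite subrr degenerate.
have q0 : (n - R) / R != 0 by rewrite mulf_neq0 ?invr_eq0 ?subr_eq0.
rewrite -[LHS](sum_affine _ (2%:R * (n - 2%:R * R) / R) q0).
apply: eq_bigr => r _; rewrite -[RHS](expf_halfMsqr _ q0); congr (_ ^+ _).
by field.
Qed.

(* If w^2 = u and w'^2 = c^2 - u then (w + w' - c)^2 = 2 (w - c)(w' - c) and   *)
(* (w - c)(- w - c) = w'^2.                                                    *)
Lemma sum_shifted_sqrt_duality (c u : F) :
  \sum_(w | w ^+ 2 == u) (w - c) ^+ m =
  2%:R ^+ m * \sum_(w | w ^+ 2 == c ^+ 2 - u) (w - c) ^+ m.
Proof.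
have two0 := two_neq0.
have two2 : 2%:R ^+ m * 2%:R ^+ m = 1 :> F.
  by rewrite -exprMn -expr2 expf_half_sqr.
pose h v := \sum_(w | w ^+ 2 == v) (w - c) ^+ m.
rewrite -/(h u) -/(h (c ^+ 2 - u)).
have sym v :
    h (c ^+ 2 - v) = 2%:R ^+ m * h v -> h v = 2%:R ^+ m * h (c ^+ 2 - v).
  by move=> ->; rewrite mulrA two2 mul1r.
have h0 : h 0 = 2%:R ^+ m * h (c ^+ 2 - 0).
  rewrite subr0 /h sum_sqrt0 sub0r.
  have [->|c0] := eqVneq c 0.
    by rewrite expr0n sum_sqrt0 subrr oppr0 exp0f_half mulr0.
  rewrite sum_sqrt // subrr exp0f_half add0r -exprMn.
  by rewrite -(expf_halfMsqr (- c) two0); congr (_ ^+ _); ring.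
(* For a nonsquare [v] the left side is empty; on the right [(w - c)(- w - c) = v], so the terms at
   [w] and [- w] cancel. *)
have hns v : v ^+ m = - 1 -> h v = 2%:R ^+ m * h (c ^+ 2 - v).
  move=> vm; rewrite [LHS]sum_sqrt_nonsquare //.
  have [v'0|v'0] := eqVneq (c ^+ 2 - v) 0.
    suff /eqP vN1 : v ^+ m == 1.
      by move: two0; rewrite -[2%:R]/(1 + 1) -{1}vN1 vm addNr eqxx.
    move/eqP: v'0; rewrite subr_eq0 => /eqP v'0.
    rewrite -v'0 expf_half_sqr //; apply: contraTneq isT => c0.
    by move: vm; rewrite -v'0 c0 expr0n exp0f_half => /esym/eqP;
      rewrite oppr_eq0 oner_eq0.
  have [v'm|v'm] := expf_half_sign v'0;
    last by rewrite /h sum_sqrt_nonsquare ?mulr0.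
  have [w wE] := euler_criterion v'm.
  have w0 : w != 0 by apply: contraNneq v'0 => w0; rewrite wE w0 expr0n.
  rewrite /h wE sum_sqrt //.
  have pm : (w - c) ^+ m * (- w - c) ^+ m = - 1.
    rewrite -exprMn -vm; congr (_ ^+ _).
    have -> : v = c ^+ 2 - w ^+ 2 by rewrite -wE subKr.
    by ring.
  have [x0|x0] := eqVneq (w - c) 0.
    by move/esym/eqP: pm; rewrite x0 exp0f_half mul0r oppr_eq0 oner_eq0.
  move: pm; have [->|->] := expf_half_sign x0; rewrite ?mul1r ?mulN1r.
    by move=> ->; rewrite subrr mulr0.
  by move=> /eqP; rewrite eqr_opp => /eqP ->; rewrite addNr mulr0.
have [->//|u0] := eqVneq u 0.
have [um|/hns//] := expf_half_sign u0.
have [u'0|u'0] := eqVneq (c ^+ 2 - u) 0.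
  by apply: sym; rewrite -{2}[u](subKr (c ^+ 2)) u'0.
have [u'm|u'm] := expf_half_sign u'0; last first.
  by apply: sym; rewrite -{2}[u](subKr (c ^+ 2)); apply: hns.
have [w wE] := euler_criterion um.
have [w' w'E] := euler_criterion u'm.
have w0 : w != 0 by apply: contraNneq u0 => w0; rewrite wE w0 expr0n.
have w'0 : w' != 0 by apply: contraNneq u'0 => h'; rewrite w'E h' expr0n.
have pE : (w - c) * (- w - c) = w' ^+ 2 by rewrite -w'E wE; ring.
have p'E : (w' - c) * (- w' - c) = w ^+ 2.
  by rewrite -wE -[RHS](subKr (c ^+ 2)) w'E; ring.
have qE : 2%:R * ((w - c) * (w' - c)) = (w + w' - c) ^+ 2.
  apply/eqP; rewrite eq_sym -subr_eq0.
  rewrite (_ : _ - _ = w ^+ 2 + w' ^+ 2 - c ^+ 2); last by ring.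
  by rewrite -wE -w'E [u + _]addrC subrK subrr.
have [x0 y0] : w - c != 0 /\ - w - c != 0.
  by apply/andP; rewrite -negb_or -mulf_eq0 pE expf_neq0.
have [x'0 y'0] : w' - c != 0 /\ - w' - c != 0.
  by apply/andP; rewrite -negb_or -mulf_eq0 p'E expf_neq0.
have z0 : w + w' - c != 0.
  by rewrite -sqrf_eq0 -qE !mulf_neq0.
have same (x y z : F) : x != 0 -> z != 0 -> x * y = z ^+ 2 -> y ^+ m = x ^+ m.
  move=> xn0 zn0 xy; rewrite -(expf_halfMsqr y xn0) expr2 -mulrA xy mulrC.
  by rewrite expf_halfMsqr.
rewrite /h [in LHS]wE w'E !sum_sqrt //.
rewrite (same _ _ _ x0 w'0 pE) (same _ _ _ x'0 w0 p'E).
have t0 : 2%:R * (w' - c) != 0 by rewrite mulf_neq0.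
have -> : (w - c) ^+ m = (2%:R * (w' - c)) ^+ m.
  by apply: (same _ _ _ t0 z0); rewrite -qE; ring.
by rewrite exprMn mulrDr.
Qed.

(** After grouping by [u = w^2], the substitution of [c^2 - u] for [u] preserves [g] and negates the
    weights. *)
Lemma sum_symmetric_twist_eq0 (g : F -> F) (c : F) : 2%:R ^+ m = - 1 :> F ->
  (forall u, g u = g (c ^+ 2 - u)) -> \sum_w (w - c) ^+ m * g (w ^+ 2) = 0.
Proof.
move=> two_m gs; pose h v := \sum_(w | w ^+ 2 == v) (w - c) ^+ m.
have -> : \sum_w (w - c) ^+ m * g (w ^+ 2) = \sum_u h u * g u.
  rewrite (partition_big (fun w => w ^+ 2) predT) //=; apply: eq_bigr => u _.
  by rewrite mulr_suml; apply: eq_bigr => w /eqP ->.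
set S := \sum_u _.
have SN : S = - S.
  rewrite {1}/S (reindex_inj (h := fun u => c ^+ 2 - u)) /=; last first.
    by move=> x y /addrI /oppr_inj.
  rewrite /S -sumrN; apply: eq_bigr => u _.
  by rewrite /h sum_shifted_sqrt_duality two_m mulN1r mulNr subKr -gs.
by apply/eqP; move/eqP: SN;
  rewrite -addr_eq0 -mulr2n -mulr_natl mulf_eq0 (negPf two_neq0).
Qed.

(** * Vanishing of the sum over the sextic *)

Section SexticSum.
Variables (t b : F).
Hypothesis two_nonsquare : 2%:R ^+ m = - 1 :> F.

Let A := t ^+ 2 - 2%:R * (t * b) + 2%:R * b ^+ 2.
Let B := t ^+ 2 - 4%:R * (t * b) + 2%:R * b ^+ 2.
Let A' := t ^+ 2 + 2%:R * (t * b) + 2%:R * b ^+ 2.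
Let B' := t ^+ 2 + 4%:R * (t * b) + 2%:R * b ^+ 2.
Let c := t ^+ 2 + 2%:R * b ^+ 2.
Let d := t ^+ 2 - 2%:R * b ^+ 2.

Let qxy (x y : F) := 2%:R * b ^+ 2 * x ^+ 2 + c * (x * y) + t ^+ 2 * y ^+ 2.
Let mixed (x y : F) :=
  - (B * B') * x ^+ 2 + 4%:R * (A * A') * (x * y) + - (B * B') * y ^+ 2.

(* The discriminant of the pencil of quadratics in z is                        *)
(* 32 (d^2 y^2 u^2 + mixed x y u + d^2 x^2).                                   *)
Lemma sum_fiber (x y : F) :
  \sum_z ((B * y ^+ 2 + 8%:R * A * (y * z) + 8%:R * B * z ^+ 2)
        * (B' * x ^+ 2 + 8%:R * A' * (x * z) + 8%:R * B' * z ^+ 2)) ^+ m =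
  (- 1) ^+ m * 2%:R ^+ m *
    \sum_r ((r ^+ 2 - 4%:R) * (d ^+ 2 * (x * y) * r + mixed x y)) ^+ m
  - (64%:R * (B * B')) ^+ m.
Proof.
rewrite -sum_palindromic -sum_elliptic_twist.
apply/eqP; rewrite -[_ == _]subr_eq0 opprB addrA subr_eq0 -mulrA; apply/eqP.
transitivity (\sum_z ((8%:R * B * z ^+ 2 + 8%:R * A * y * z + B * y ^+ 2)
        * (8%:R * B' * z ^+ 2 + 8%:R * A' * x * z + B' * x ^+ 2)) ^+ m
        + (8%:R * B * (8%:R * B')) ^+ m).
  congr (_ + _); last by congr (_ ^+ _); ring.
  by apply: eq_bigr => z _; congr (_ ^+ _); ring.
rewrite sum_quadratic_pencil [in RHS]mulr_sumr; congr (_ * _);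
  apply: eq_bigr => u _.
(* Since [32 = 4^2 * 2], only the character of 2 survives from the constant. *)
have four0 : 4%:R != 0 :> F.
  by rewrite -[4%N]/(2 * 2)%N natrM mulf_neq0 ?two_neq0.
rewrite -exprMn -[RHS](expf_halfMsqr _ four0); congr (_ ^+ _).
by rewrite /mixed /d /A /B /A' /B'; ring.
Qed.

Lemma sum_sextic_eq0 : \sum_x \sum_y \sum_z sextic t b x y z ^+ m = 0.
Proof.
rewrite /sextic; pose k : F := (- 1) ^+ m * 2%:R ^+ m.
pose n := B * B'.
pose ell R := \sum_r ((r ^+ 2 - 4%:R) * (R * r + (6%:R * R - 4%:R * n))) ^+ m.
transitivity (k * \sum_r \sum_x \sum_y (r ^+ 2 - 4%:R) ^+ m *
    (qxy x y * (d ^+ 2 * (x * y) * r + mixed x y)) ^+ m).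
  rewrite [in RHS]exchange_big /=.
  under [in RHS]eq_bigr do rewrite exchange_big /=.
  transitivity (\sum_x \sum_y (k * \sum_r (r ^+ 2 - 4%:R) ^+ m *
    (qxy x y * (d ^+ 2 * (x * y) * r + mixed x y)) ^+ m
     - (64%:R * (B * B')) ^+ m * qxy x y ^+ m)).
    apply: eq_bigr => x _; apply: eq_bigr => y _.
    under eq_bigr do rewrite exprMn.
    rewrite -mulr_suml -/(qxy x y) sum_fiber -/k mulrBl -[k * _ * _]mulrA.
    congr (k * _ - _).
    by rewrite mulr_suml; apply: eq_bigr => r _; rewrite !exprMn; ring.
  (* The boundary term of [sum_fiber] is independent of [x] and [y], and [qxy ^+ m] sums to 0 over
     the plane. *)
  pose w := (64%:R * (B * B')) ^+ m.
  rewrite -[RHS]subr0 -[X in _ = _ - X](mulr0 w).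
  have q0 := sum_binary_quadratic_half (2%:R * b ^+ 2) c (t ^+ 2).
  rewrite -[X in _ = _ - w * X]q0.
  rewrite !mulr_sumr -sumrB; apply: eq_bigr => x _.
  by rewrite !mulr_sumr -sumrB.
(* The pencil variable is u = (r + 6) v, which makes the integrand linear in   *)
(* r outside the factor r^2 - 4.                                               *)
suff /eqP : \sum_r \sum_v v ^+ m * ((r ^+ 2 - 4%:R) *
    ((v ^+ 2 + 2%:R * c * v + d ^+ 2) * r
     + (6%:R * (v ^+ 2 + 2%:R * c * v + d ^+ 2) - 4%:R * n))) ^+ m = 0.
  move=> /eqP h; apply/eqP; rewrite mulf_eq0; apply/orP; right; apply/eqP.
  (* The discriminant of this pencil is divisible by [d^2], because [c^2 - 8 t^2 b^2 = d^2] and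
     [4 A A' + 2 n = 6 d^2]; the latter also produces [r + 6]. *)
  pose K := (- (- 1) ^+ m) * (d ^+ 2) ^+ m.
  rewrite -[RHS](mulr0 K) -[in RHS]h mulr_sumr; apply: eq_bigr => r _.
  under eq_bigr do rewrite -mulr_sumr.
  rewrite -mulr_sumr.
  rewrite (_ : \sum_x _ = K * \sum_v (v * (v ^+ 2 + 2%:R * c * v * (r + 6%:R)
     + (r + 6%:R) * (d ^+ 2 * r + 6%:R * d ^+ 2 - 4%:R * n))) ^+ m); last first.
    transitivity (\sum_x \sum_y (qxy x y * (- (B * B') * x ^+ 2
         + (4%:R * (A * A') + d ^+ 2 * r) * (x * y)
         + - (B * B') * y ^+ 2)) ^+ m).
      by apply: eq_bigr => x _; apply: eq_bigr => y _; congr (_ ^+ _);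
        rewrite /mixed; ring.
    rewrite sum_binary_quadratic_pair /K -mulrA; congr (_ * _).
    rewrite mulr_sumr; apply: eq_bigr => v _; rewrite -exprMn; congr (_ ^+ _).
    by rewrite /n /c /d /A /B /A' /B'; ring.
  rewrite mulrCA; congr (_ * _); rewrite mulr_sumr.
  (* At [r = -6] the substitution degenerates, but both sides are multiples of the sum of [v ^+ m],
     which is 0. *)
  have [r6|r6] := eqVneq (r + 6%:R) 0.
    pose a := ((r ^+ 2 - 4%:R) * - (4%:R * n)) ^+ m.
    transitivity (\sum_v v ^+ m * (r ^+ 2 - 4%:R) ^+ m).
      apply: eq_bigr => v _; have [->|v0] := eqVneq v 0.
        by rewrite mul0r !exp0f_half mulr0 mul0r.
      rewrite -!exprMn r6 -[RHS](expf_halfMsqr _ v0); congr (_ ^+ _); ring.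
    rewrite -mulr_suml sum_half_power mul0r; symmetry.
    transitivity (\sum_v v ^+ m * a);
      last by rewrite -mulr_suml sum_half_power mul0r.
    apply: eq_bigr => v _; congr (_ * _ ^+ m).
    by rewrite (_ : r = - 6%:R); [ring | apply/eqP; rewrite -addr_eq0 r6].
  rewrite -[LHS](sum_affine _ 0 r6); apply: eq_bigr => v _.
  rewrite -!exprMn -[RHS](expf_halfMsqr _ r6); congr (_ ^+ _); ring.
rewrite exchange_big /=.
transitivity (\sum_v v ^+ m * ell (v ^+ 2 + 2%:R * c * v + d ^+ 2)).
  by apply: eq_bigr => v _; rewrite mulr_sumr.
(* Completing the square, [v = w - c] and [u = w^2]. As [n = 2 d^2 - c^2], passing from [R] to
   [n - R] is passing from [u] to [c^2 - u]. *)
pose g u := ell (u - c ^+ 2 + d ^+ 2).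
rewrite -[RHS](@sum_symmetric_twist_eq0 g c) // => [|u].
  rewrite -[LHS](sum_affine _ (- c) (oner_neq0 F)); apply: eq_bigr => w _.
  by rewrite mul1r; congr (_ * ell _); ring.
rewrite /g {1}/ell sum_legendre_symmetry; congr (ell _).
by rewrite /n /c /d /B /B'; ring.
Qed.

End SexticSum.

End QuadraticCharacterSums.

(** * Two is not a square *)

(* X - X^3 is a square root of 2 modulo X^4 + 1: a sum zeta + zeta^-1 for a    *)
(* primitive eighth root of unity zeta, and Frobenius changes its sign.        *)
Lemma two_nonsquare_Fp (p : nat) : prime p -> (p %% 8 = 3 \/ p %% 8 = 5)%N ->
  2%:R ^+ p./2 = - 1 :> 'F_p.
Proof.
move=> p_prime p8; set F := 'F_p.
have p_odd : odd p.
  by rewrite (divn_eq p 8) oddD oddM andbF; case: p8 => ->.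
pose h : {poly F} := 'X^4 + 1; pose y : {poly F} := 'X - 'X^3.
have frob : y ^+ p = 'X ^+ p - ('X ^+ p) ^+ 3.
  have pcharP : p \in [pchar {poly F}].
    exact: (rmorph_pchar polyC (pchar_Fp p_prime)).
  rewrite -(pFrobenius_autE pcharP) rmorphB /= !pFrobenius_autE.
  by rewrite -!exprM mulnC.
have y2 : h %| y ^+ 2 - 2%:R.
  by apply/dvdpP; exists ('X^2 - 2%:R); rewrite /y /h; ring.
have cong_exp (u v : {poly F}) n : h %| u - v -> h %| u ^+ n - v ^+ n.
  by move=> uv; rewrite subrXX dvdp_mulr.
have X8 : h %| 'X^8 - 1.
  by apply/dvdpP; exists ('X^4 - 1); rewrite /h; ring.
have Xp : h %| 'X ^+ p - 'X ^+ (p %% 8).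
  have -> : 'X ^+ p = ('X ^+ 8) ^+ (p %/ 8) * 'X ^+ (p %% 8) :> {poly F}.
    by rewrite -exprM -exprD [(8 * _)%N]mulnC -divn_eq.
  rewrite -{2}['X^(p %% 8)]mul1r -mulrBl.
  by rewrite dvdp_mulr // -(expr1n _ (p %/ 8)) cong_exp.
have yp : h %| y ^+ p + y.
  rewrite frob.
  have -> : 'X ^+ p - ('X ^+ p) ^+ 3 + y = ('X ^+ p - 'X ^+ (p %% 8))
     - (('X ^+ p) ^+ 3 - ('X ^+ (p %% 8)) ^+ 3)
     + ('X ^+ (p %% 8) - ('X ^+ (p %% 8)) ^+ 3 + y) by ring.
  apply: dvdp_add; first by apply: dvdp_sub => //; apply: cong_exp.
  case: p8 => ->; apply/dvdpP; rewrite /y /h.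
    by exists ('X - 'X^5); ring.
  by exists ('X - 'X^3 + 'X^7 - 'X^11); ring.
have yp' : h %| y ^+ p - (2%:R ^+ p./2) * y.
  have -> : y ^+ p = (y ^+ 2) ^+ p./2 * y.
    rewrite -exprM mul2n -exprSr; congr (_ ^+ _).
    by rewrite -[LHS]odd_double_half p_odd.
  rewrite -mulrBl.
  by rewrite dvdp_mulr // cong_exp.
have : h %| (1 + 2%:R ^+ p./2)%:P * y.
  have -> : (1 + 2%:R ^+ p./2)%:P * y =
    (y ^+ p + y) - (y ^+ p - (2%:R ^+ p./2) * y).
    rewrite rmorphD rmorph1 rmorphXn rmorph_nat; ring.
  by rewrite dvdp_sub.
(* As [y] has degree 3 and [h] degree 4, [h] divides a constant multiple of [y] only if the constant
   is 0. *)
rewrite mul_polyC; apply: contraTeq => two.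
have two0 : 1 + 2%:R ^+ p./2 != 0 :> F by rewrite addrC addr_eq0.
rewrite dvdpZr //; apply/negP => /dvdp_leq.
have sy : size y = 4%N.
  by rewrite /y addrC size_addl ?size_opp ?size_polyXn // size_polyX.
rewrite -size_poly_eq0 sy => /(_ isT).
by rewrite /h size_addl ?size_polyXn // size_poly1.
Qed.

(** * Points of a double plane *)

Section DoublePlane.
Variable F : finFieldType.

Lemma card_nonzero_scalars : #|[set c : F | c != 0]| = #|F|.-1.
Proof. by rewrite -(cardC1 (0 : F)) cardsE. Qed.

Lemma wscaleM (c d : F) v : wscale c (wscale d v) = wscale (c * d) v.
Proof. by apply/ffunP => i; rewrite !ffunE exprMn mulrA. Qed.

Lemma wscale1 (v : {ffun 'I_4 -> F}) : wscale 1 v = v.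
Proof. by apply/ffunP => i; rewrite !ffunE expr1n mul1r. Qed.

Lemma wpoint_wscale (c : F) v : c != 0 -> wpoint (wscale c v) = wpoint v.
Proof.
move=> c0; apply/setP => u; apply/imsetP/imsetP => -[d]; rewrite inE => d0 ->.
  by exists (d * c); rewrite ?inE ?mulf_neq0 // wscaleM.
by exists (d / c); rewrite ?inE ?mulf_neq0 ?invr_eq0 // wscaleM divfK.
Qed.

Lemma mem_wpoint (v : {ffun 'I_4 -> F}) : v \in wpoint v.
Proof. by apply/imsetP; exists 1; rewrite ?inE ?oner_neq0 ?wscale1. Qed.

(** A nonzero coordinate of weight 1 determines the scalar, so the action is free on this orbit. *)
Lemma card_wpoint (v : {ffun 'I_4 -> F}) i : i != iw -> v i != 0 ->
  #|wpoint v| = #|F|.-1.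
Proof.
move=> iNw vi; rewrite card_imset ?card_nonzero_scalars // => c d.
move=> /ffunP/(_ i); rewrite !ffunE /weight (negPf iNw) !expr1.
exact: mulIf.
Qed.

Lemma wpoint_partition (f : {mpoly F[4]}) :
  (forall (c : F) (v : {ffun 'I_4 -> F}),
    c != 0 -> f.@[v] = 0 -> f.@[wscale c v] = 0) ->
  partition (wpoints f) [set v : {ffun 'I_4 -> F} | (v != 0) && (f.@[v] == 0)].
Proof.
move=> f_scale.
have memP (c : F) (v : {ffun 'I_4 -> F}) : c != 0 -> v != 0 -> f.@[v] == 0 ->
    (wscale c v != 0) && (f.@[wscale c v] == 0).
  move=> c0 v0 /eqP fv; rewrite f_scale ?eqxx // andbT.
  apply: contraNneq v0 => cv0; rewrite -[v]wscale1 -(mulVf c0) -wscaleM cv0.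
  by apply/eqP/ffunP => i; rewrite !ffunE mulr0.
apply/and3P; split.
- apply/eqP/setP => v; rewrite inE; apply/bigcupP/idP => [[A /imsetP[u]]|vP].
    rewrite inE => /andP[u0 fu] -> /imsetP[c]; rewrite inE => c0 ->.
    exact: memP.
  exists (wpoint v); last exact: mem_wpoint.
  by apply/imsetP; exists v; rewrite ?inE.
- apply/trivIsetP => A B /imsetP[u _ ->] /imsetP[v _ ->]; apply: contraR.
  move=> /pred0Pn[w /andP[/= /imsetP[c]]].
  rewrite inE => c0 -> /imsetP[d]; rewrite inE => d0 wE.
  by rewrite -(wpoint_wscale u c0) wE wpoint_wscale.
- by apply/imsetP => -[v _] /setP/(_ v); rewrite mem_wpoint inE.
Qed.

Lemma sum_ffun4 (V : nmodType) (G : {ffun 'I_4 -> F} -> V) :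
  \sum_v G v =
  \sum_x \sum_y \sum_z \sum_w G [ffun i : 'I_4 => [:: x; y; z; w]`_i].
Proof.
pose h (q : F * F * F * F) : {ffun 'I_4 -> F} :=
  [ffun i : 'I_4 => [:: q.1.1.1; q.1.1.2; q.1.2; q.2]`_i].
rewrite (reindex h) /=; last first.
  exists (fun v => (v ix, v iy, v iz, v iw)) => [[[[x y] z] w] _|v _].
    by rewrite /h !ffunE.
  apply/ffunP => i; rewrite ffunE /=.
  by case: i => -[|[|[|[|//]]]] Hi /=; congr (v _); apply: val_inj.
rewrite -(pair_bigA _ (fun q w => G (h (q, w)))) /=.
rewrite -(pair_bigA _ (fun q z => \sum_w G (h (q, z, w)))) /=.
by rewrite -(pair_bigA _ (fun x y => \sum_z \sum_w G (h (x, y, z, w)))).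
Qed.

(* Each F^*-orbit has #|F| - 1, i.e. -1 in F, elements, and w^2 = g has        *)
(* 1 + g^m solutions in F, so the points are counted by 1 - \sum (1 + g^m).    *)
Lemma card_wpoints_double_plane (m : nat) (f : {mpoly F[4]}) (k : F)
    (g : F -> F -> F -> F) : #|F| = m.*2.+1 -> k != 0 ->
  (forall c x y z, g (c * x) (c * y) (c * z) = c ^+ 6 * g x y z) ->
  (forall v, (f.@[v] == 0) = ((k * v iw) ^+ 2 == g (v ix) (v iy) (v iz))) ->
  #|wpoints f|%:R = 1 - \sum_x \sum_y \sum_z g x y z ^+ m.
Proof.
move=> cardF k0 gM fE.
have g0 : g 0 0 0 = 0 by have := gM 0 0 0 0; rewrite !mulr0 expr0n mul0r.
pose D := [set v : {ffun 'I_4 -> F} | (v != 0) && (f.@[v] == 0)].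
have nonzero (v : {ffun 'I_4 -> F}) : v \in D -> exists2 i, i != iw & v i != 0.
  rewrite inE fE => /andP[v0 fv].
  apply/exists_inP; apply: contraNT v0 => /exists_inPn v0.
  have vE i : i != iw -> v i = 0 by move=> /v0; rewrite negbK => /eqP.
  have vw : v iw = 0.
    move: fv; rewrite (vE ix) // (vE iy) // (vE iz) // g0 sqrf_eq0.
    by rewrite mulf_eq0 (negPf k0) => /eqP.
  by apply/eqP/ffunP => i; rewrite ffunE; have [->|/vE] := eqVneq i iw.
have cardD : #|D| = (#|wpoints f| * m.*2)%N.
  apply: (card_uniform_partition _ (wpoint_partition _)).
    move=> A /imsetP[v /nonzero[i iw vi] ->].
    by rewrite (card_wpoint iw vi) cardF.
  move=> c v c0 /eqP; rewrite fE => /eqP fv; apply/eqP; rewrite fE !ffunE /=.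
  rewrite !expr1 gM -fv; apply/eqP; ring.
have F0 : #|F|%:R = 0 :> F by have := sum_const0 (1 : F); rewrite sumr_const.
have m2 : m.*2%:R = - 1 :> F.
  by move: F0; rewrite cardF -addn1 natrD => /eqP; rewrite addr_eq0 => /eqP.
have -> : #|wpoints f|%:R = - #|D|%:R :> F.
  by rewrite cardD natrM m2 mulrN1 opprK.
have f0 : f.@[(0 : {ffun 'I_4 -> F})] == 0 by rewrite fE !ffunE g0 mulr0 expr0n.
have DE : 1 + #|D|%:R = \sum_(v : {ffun 'I_4 -> F} | f.@[v] == 0) 1 :> F.
  rewrite (bigD1 (0 : {ffun 'I_4 -> F})) //=; congr (_ + _).
  rewrite -sum1_card natr_sum; apply: eq_bigl => v.
  by rewrite inE andbC.
have -> : - #|D|%:R = 1 - \sum_(v : {ffun 'I_4 -> F} | f.@[v] == 0) 1 :> F.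
  by rewrite -DE opprD addrA subrr add0r.
congr (_ - _); rewrite big_mkcond sum_ffun4 /=.
apply: eq_bigr => x _.
transitivity (\sum_y ((\sum_(z : F) 1) + \sum_z g x y z ^+ m)); last first.
  by apply: eq_bigr => y _; rewrite sum_const0 add0r.
apply: eq_bigr => y _; rewrite -big_split /=; apply: eq_bigr => z _.
rewrite -big_mkcond /=.
under eq_bigl do rewrite fE !ffunE /=.
rewrite -(card_sqrt cardF) [RHS](reindex_inj (mulfI k0)) /=.
by apply: eq_bigl => w.
Qed.

End DoublePlane.

(** * Reduction of the integral model *)

(** The factor [k] on [w] absorbs cleared denominators, so one equation over the integers maps to
    both [rat] and ['F_p]. *)
Definition sextic_model (R : comNzRingType) (t b k : R) : {mpoly R[4]} :=
  let x : {mpoly R[4]} := 'X_ix in let y : {mpoly R[4]} := 'X_iy in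
  let z : {mpoly R[4]} := 'X_iz in let w : {mpoly R[4]} := 'X_iw in
  let A := t ^+ 2 - 2%:R * (t * b) + 2%:R * b ^+ 2 in
  let B := t ^+ 2 - 4%:R * (t * b) + 2%:R * b ^+ 2 in
  let A' := t ^+ 2 + 2%:R * (t * b) + 2%:R * b ^+ 2 in
  let B' := t ^+ 2 + 4%:R * (t * b) + 2%:R * b ^+ 2 in
  k ^+ 2 *: w ^+ 2
  - (B *: y ^+ 2 + (8%:R * A) *: (y * z) + (8%:R * B) *: z ^+ 2)
  * (B' *: x ^+ 2 + (8%:R * A') *: (x * z) + (8%:R * B') *: z ^+ 2)
  * ((2%:R * b ^+ 2) *: x ^+ 2 + (t ^+ 2 + 2%:R * b ^+ 2) *: (x * y)
     + t ^+ 2 *: y ^+ 2).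

Lemma map_sextic_model (R S : comNzRingType) (f : {rmorphism R -> S}) t b k :
  map_mpoly f (sextic_model t b k) = sextic_model (f t) (f b) (f k).
Proof.
rewrite /sextic_model !(rmorphB, rmorphD, rmorphM) /= !map_mpolyZ.
by rewrite !(rmorph_nat, rmorphB, rmorphD, rmorphM, rmorphXn) /= !map_mpolyX.
Qed.

Lemma eval_sextic_model (R : comNzRingType) (t b k : R) (v : 'I_4 -> R) :
  (sextic_model t b k).@[v] = (k * v iw) ^+ 2 - sextic t b (v ix) (v iy) (v iz).
Proof.
rewrite /sextic_model /sextic !(rmorphB, rmorphD, rmorphM) /= !mevalZ.
by rewrite !(rmorphM, rmorphXn) /= !mevalXU exprMn.
Qed.

Lemma sextic_modelE (t b k : rat) :
  sextic_model (t * b) b k = k ^+ 2 *: 'X_iw ^+ 2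
    - (8%:R * b ^+ 3) ^+ 2 *: (qf_yz t * qf_xz t * qf_xy t).
Proof.
have scaleM (u v w : rat) (q q' q'' : {mpoly rat[4]}) :
    (u * v * w) *: (q * q' * q'') = (u *: q) * (v *: q') * (w *: q'').
  by rewrite -!(scalerAl, scalerAr) !scalerA; congr (_ *: _); ring.
have -> : (8%:R * b ^+ 3) ^+ 2 =
  (8%:R * b ^+ 2) * (8%:R * b ^+ 2) * b ^+ 2 by ring.
rewrite /sextic_model scaleM /qf_yz /qf_xz /qf_xy !scalerDr !scalerA.
congr (_ - _); congr (_ * _ * _).
- congr (_ + _ + _); congr (_ *: _); by field.
- congr (_ + _ + _); congr (_ *: _); by field.
- congr (_ + _ + _); congr (_ *: _); ring.
Qed.

(** If [p] divided the denominator of [x], coprimality would make it divide [k]; hence [ratr] does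
    not divide by 0 here. *)
Lemma ratr_Fp (p : nat) (k n : int) (x : rat) : prime p ->
  k%:~R != 0 :> 'F_p -> k%:~R * x = n%:~R -> k%:~R * ratr x = n%:~R :> 'F_p.
Proof.
move=> p_prime k0 kx; have pP := pchar_Fp p_prime.
have E : k * numq x = n * denq x.
  apply/eqP; rewrite -(eqr_int rat) !intrM -kx -{2}[x]divq_num_den -mulrA.
  by rewrite divfK // intr_eq0 denq_neq0.
have d0 : (denq x)%:~R != 0 :> 'F_p.
  apply: contra k0; rewrite -!(dvdz_pcharf pP) => pd.
  have : (p %| k * numq x)%Z by rewrite E dvdz_mull.
  rewrite Gauss_dvdzl // coprimezE (coprime_dvdl pd) //.
  by rewrite coprime_sym coprime_num_den.
by rewrite /ratr mulrA -intrM E intrM mulfK.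
Qed.

(** Since [ratr] into ['F_p] is not a ring morphism, reduction is compared coefficient by
    coefficient on the common support. *)
Lemma map_mpoly_ratr_Fp (p n : nat) (k : int) (P : {mpoly int[n]})
    (M : {mpoly rat[n]}) : prime p -> k%:~R != 0 :> 'F_p ->
  map_mpoly (intr : int -> rat) P = k%:~R *: M ->
  map_mpoly (intr : int -> 'F_p) P = k%:~R *: map_mpoly (ratr : rat -> 'F_p) M.
Proof.
move=> p_prime k0 PM.
have k0' : k%:~R != 0 :> rat.
  by rewrite intr_eq0; apply: contraNneq k0 => ->.
have supp : perm_eq (msupp P) (msupp M).
  apply: perm_trans (msuppZ _ k0'); rewrite -PM perm_sym.
  by apply: msupp_map_mpoly; apply: intr_inj.
rewrite /map_mpoly /mmap (perm_big _ supp) scaler_sumr;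
  apply: eq_bigr => m _ /=.
rewrite scalerAl; congr (_ * _); rewrite -mul_mpolyC -mpolyCM; congr (_%:MP).
symmetry; apply: ratr_Fp => //.
by rewrite -mcoeffZ -PM mcoeff_map_mpoly.
Qed.

(** In the first case [X2_model] already carries the factor [b^6], so only [8^2] remains to be
    cleared. *)
Definition model_scale (t : rat) (p : nat) : int :=
  if (p %| `|denq t|)%N then 8 else 8 * denq t ^+ 3.

Lemma map_integral_model (t : rat) (p : nat) (k := model_scale t p) :
  map_mpoly (intr : int -> rat) (sextic_model (numq t) (denq t) k) =
  (k ^+ 2)%:~R *: X2_model t p.
Proof.
rewrite map_sextic_model /= numqE sextic_modelE /k /model_scale /X2_model
  /X2_eq.
case: ifP => _.
  rewrite -!(scalerAl, scalerAr) !scalerA scalerBr scalerA rmorphXn.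
  by congr (_ - _ *: _); ring.
by rewrite scalerBr rmorphXn /= intrM [(_ ^+ 3)%:~R]rmorphXn.
Qed.

Lemma model_scale_neq0 (t : rat) (p : nat) : prime p -> 2%:R != 0 :> 'F_p ->
  (model_scale t p)%:~R != 0 :> 'F_p.
Proof.
move=> p_prime two0.
have eight0 : 8%:~R != 0 :> 'F_p.
  by rewrite (_ : 8%:~R = 2%:R ^+ 3) ?expf_neq0 // -natrX.
rewrite /model_scale; case: ifPn => // pd.
by rewrite intrM rmorphXn mulf_neq0 // expf_neq0 //
  -(dvdz_pcharf (pchar_Fp p_prime)).
Qed.

Lemma card_wpoints_X2_red (t : rat) (p : nat) : prime p ->
  (p %% 8 = 3 \/ p %% 8 = 5)%N -> #|wpoints (X2_red t p)|%:R = 1 :> 'F_p.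
Proof.
move=> p_prime p8.
have two_m := two_nonsquare_Fp p_prime p8.
have cardF : #|'F_p| = p./2.*2.+1.
  rewrite card_Fp // -[LHS](odd_double_half p).
  by rewrite [odd p](_ : _ = true) // (divn_eq p 8) oddD oddM andbF;
    case: p8 => ->.
have k0 := model_scale_neq0 t p_prime (two_neq0 cardF).
have k20 : (model_scale t p ^+ 2)%:~R != 0 :> 'F_p.
  by rewrite rmorphXn expf_neq0.
have := map_mpoly_ratr_Fp p_prime k20 (map_integral_model t p).
rewrite map_sextic_model /= => E.
pose g := sextic ((numq t)%:~R : 'F_p) (denq t)%:~R.
rewrite (card_wpoints_double_plane (g := g) cardF k0) => [|c x y z|v].
- by rewrite (sum_sextic_eq0 cardF _ _ two_m) subr0.
- by rewrite /g /sextic; ring.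
- by rewrite -[RHS]subr_eq0 -eval_sextic_model E mevalZ mulf_eq0 (negPf k20).
Qed.

End Reduction.

Theorem theorem5p12 (t : rat) (p : nat) (p_prime : prime p)
    (p_mod8 : p %% 8 = 3 \/ p %% 8 = 5) :
  #|wpoints (X2_red t p)| = 1 %[mod p].
Proof.
by rewrite -!(val_Fp_nat p_prime) (card_wpoints_X2_red t p_prime p_mod8).
Qed.
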